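(* Let $\Sigma$ be a compact Hausdorff space, $X=\Sigma^{\mathbb Z}$ with the product topology and $S:X\to X$ the left shift. Let $x\in X$ be an aperiodic recurrent sequence with $\limsup_{p\to\infty}M_p(x)=\infty$, and let $\{p_i\}_{i\in\mathbb N}$ be a strictly increasing sequence of natural numbers such that (i) $p_i\in\mathcal P(x)$ for all $i$; (ii) $p_i\mid p_{i+1}$ for all $i$; (iii$'$) $\lim_{i\to\infty}M_{p_i}(x)=\infty$ (that is, $\{p_i\}$ is a periodic structure of $x$). Then there exists a (nonperiodic) Toeplitz sequence $\eta\in X$ such that $\overline{\mathrm{Orb}(x)}=\overline{\mathrm{Orb}(\eta)}$ and $\{p_i\}$ is a periodic structure of the Toeplitz sequence $\eta$, i.e. $p_i\in\mathcal P(\eta)$ and $p_i\mid p_{i+1}$ for all $i$, and $\bigcup_{i\in\mathbb N}\mathrm{Per}_{p_i}(\eta)=\mathbb Z$.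
   Context: $\mathbb N=\{1,2,\dots\}$. Elements of $X$ are written $x=(x(n))_{n\in\mathbb Z}$; the left shift is the homeomorphism $(Sx)(n)=x(n+1)$. $\mathrm{Orb}(x)=\{S^k x: k\in\mathbb Z\}$ and the bar denotes closure in $X$. A sequence is aperiodic (nonperiodic) if $S^k x\neq x$ for all $k\in\mathbb N$. For $x\in X$, $p\in\mathbb N$, $\sigma\in\Sigma$: $\mathrm{Per}_p(x,\sigma)=\{n\in\mathbb Z : x(n')=\sigma \text{ for all } n'\equiv n \pmod p\}$, $\mathrm{Per}_p(x)=\bigcup_{\sigma\in\Sigma}\mathrm{Per}_p(x,\sigma)$, $\mathrm{Aper}(x)=\mathbb Z\setminus\bigcup_{p\in\mathbb N}\mathrm{Per}_p(x)$. $M_p(x)=\max\{k\in\mathbb N : \exists n\in\mathbb Z,\ n+i\in\mathrm{Per}_p(x) \text{ for } i=0,1,\dots,k-1\}$ (with value $\infty$ if such lengths are unbounded, and $0$ if $\mathrm{Per}_p(x)=\emptyset$). A number $p\in\mathbb N$ is an essential period of $x$, written $p\in\mathcal P(x)$, if for every $q\in\mathbb N$: whenever $\mathrm{Per}_p(x,\sigma)\subseteq\mathrm{Per}_p(x,\sigma)-q$ for all $\sigma\in\Sigma$, then $p\mid q$. A sequence $\eta\in X$ is Toeplitz if $\mathrm{Aper}(\eta)=\emptyset$. A point $x$ is recurrent (in this paper's sense) if for every open neighbourhood $U$ of $x$ there is $n(U)\in\mathbb N$ such that for every $k\in\mathbb Z$, $U\cap\{S^i x: k\le i\le k+n(U)-1\}\ne\emptyset$.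 *)

(* Defs.v *)
From HB Require Import structures.
From mathcomp Require Import all_boot all_order all_algebra.
From mathcomp Require Import all_classical all_reals all_analysis.
Import Order.TTheory GRing.Theory Num.Theory.
Set Implicit Arguments.
Unset Strict Implicit.
Unset Printing Implicit Defensive.

Local Open Scope classical_set_scope.
Local Open Scope ring_scope.

Definition shift (Sigma : Type) (x : {ptws int -> Sigma}) :
  {ptws int -> Sigma} := fun n => x (n + 1).

(* The integer power S^k of the homeomorphism [shift]; the two lemmas below
   characterize it. *)
Definition shiftz (Sigma : Type) (k : int) (x : {ptws int -> Sigma}) :
  {ptws int -> Sigma} := fun n => x (n + k).

Lemma shiftz0 (Sigma : Type) (x : {ptws int -> Sigma}) : shiftz 0 x = x.
Proof. by apply/funext => n; rewrite /shiftz addr0. Qed.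

Lemma shiftzS (Sigma : Type) (k : int) (x : {ptws int -> Sigma}) :
  shiftz (k + 1) x = shift (shiftz k x).
Proof. by apply/funext => n; rewrite /shift /shiftz addrA addrAC. Qed.

Definition Orb (Sigma : Type) (x : {ptws int -> Sigma}) :
  set {ptws int -> Sigma} := [set shiftz k x | k in [set: int]].

Definition aperiodic (Sigma : Type) (x : {ptws int -> Sigma}) : Prop :=
  forall k : nat, (0 < k)%N -> shiftz k%:Z x <> x.

(* Periods are positive. [Per] and [M] are total in [p : nat], but their value
   at [p = 0] is never relevant: it is excluded in [essential_period] and
   [Aper], and does not affect limits as p tends to infinity. *)
Definition Per (Sigma : Type) (p : nat) (x : {ptws int -> Sigma})
    (sigma : Sigma) : set int :=
  [set n | forall n' : int, (n' = n %[mod p%:Z])%Z -> x n' = sigma].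

Definition PerU (Sigma : Type) (p : nat) (x : {ptws int -> Sigma}) : set int :=
  \bigcup_(sigma in [set: Sigma]) Per p x sigma.

Definition Aper (Sigma : Type) (x : {ptws int -> Sigma}) : set int :=
  ~` \bigcup_(p in [set p : nat | (0 < p)%N]) PerU p x.

(* The maximal length of a block of consecutive integers in [PerU p x]. The
   length k = 0 is always admissible, so the supremum is 0 if [PerU p x] is
   empty, and +oo if the lengths are unbounded. The real field R only serves to
   provide the extended values. *)
Definition M (R : realType) (Sigma : Type) (p : nat)
    (x : {ptws int -> Sigma}) : \bar R :=
  ereal_sup [set k%:R%:E | k in [set k : nat |
    exists n : int, forall i : nat, (i < k)%N -> PerU p x (n + i%:Z)]].

Definition essential_period (Sigma : Type) (p : nat)
    (x : {ptws int -> Sigma}) : Prop :=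
  (0 < p)%N /\
  forall q : nat, (0 < q)%N ->
    (forall sigma : Sigma,
      Per p x sigma `<=` [set n - q%:Z | n in Per p x sigma]) ->
    (p %| q)%N.

Definition toeplitz (Sigma : Type) (x : {ptws int -> Sigma}) : Prop :=
  Aper x = set0.

(* Return times are required to be syndetic; this is stronger than the usual
   topological recurrence. *)
Definition recurrent (Sigma : topologicalType)
    (x : {ptws int -> Sigma}) : Prop :=
  forall U : set {ptws int -> Sigma}, open U -> U x ->
    exists N : nat, (0 < N)%N /\
      forall k : int,
        U `&` [set shiftz i x | i in [set i : int | k <= i <= k + N%:Z - 1]]
          !=set0.

(* Main.v *)
Require Import Defs.
From HB Require Import structures.
From mathcomp Require Import all_boot all_order all_algebra.
From mathcomp Require Import all_classical all_reals all_analysis.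
From mathcomp Require Import zify.
Import Order.TTheory GRing.Theory Num.Theory.
Set Implicit Arguments.
Unset Strict Implicit.
Unset Printing Implicit Defensive.

(** The sequence [eta] is a limit of shifts [S^{n_k} x].  Since the periodic
    parts [Per_{p_i}(x)] contain arbitrarily long blocks, one can choose indices
    [i_0 <= i_1 <= ...] and centres [n_k] such that the window of radius [k]
    around [n_k] lies in [Per_{p_{i_k}}(x)] and [n_{k+1}] is congruent to [n_k]
    modulo [p_{i_k}]: a block longer than the window by [p_{i_k}] leaves room
    for every residue ([Per_window_mod]).  The congruences make each coordinate
    of [S^{n_k} x] eventually constant, and put the window [[-k, k]] into
    [Per_{p_{i_k}}(eta)]; so [eta] exists, lies in the orbit closure of [x], and
    the sets [Per_{p_i}(eta)] cover the integers ([toeplitz_limit]).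

    As [x] returns syndetically to each of its neighbourhoods, its orbit closure
    is minimal, and [eta] has the same one ([recurrent_closure_Orb]).

    The essential periods are then transferred for free: each of [x] and [eta]
    lies in the orbit closure of the other, so for each positive [p] the family
    [Per_p(x, s)], indexed by [s], embeds into the family [Per_p(eta, s)] up to
    a translation common to all [s], and conversely ([Per_closure]).  These two
    inclusions suffice for [p] to be an essential period of both or of neither
    ([essential_period_closure]).  Finally a period of [eta] would be divisible
    by all the [p_i], which are unbounded. *)

Local Open Scope classical_set_scope.
Local Open Scope ring_scope.

Lemma shiftzD (Sigma : Type) (k l : int) (x : {ptws int -> Sigma}) :
  shiftz k (shiftz l x) = shiftz (k + l) x.
Proof. by apply/funext => n; rewrite /shiftz addrA. Qed.

Lemma mem_shift_Orb (Sigma : Type) (x : {ptws int -> Sigma}) (k : int) :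
  Orb x (shiftz k x).
Proof. by exists k. Qed.

Lemma mem_Orb (Sigma : Type) (x : {ptws int -> Sigma}) : Orb x x.
Proof. by rewrite -[X in Orb _ X]shiftz0; exact: mem_shift_Orb. Qed.

Lemma eqmod_dvdz (n m : int) (p : nat) :
  (n = m %[mod p])%Z <-> (p %| n - m)%Z.
Proof. by rewrite -eqz_mod_dvd; split=> /eqP. Qed.

(** * Orbit closures *)

Section Topology.
Context {Sigma : topologicalType}.
Implicit Types x y : {ptws int -> Sigma}.

Lemma ptws_cvg (T : Type) (F : set_system T) {FF : Filter F}
    (u : T -> {ptws int -> Sigma}) x :
  (forall n, (fun t => u t n) @ F --> x n) -> u @ F --> x.
Proof.
move=> ux; apply/cvg_sup => n; apply/cvg_image.
  by rewrite eqEsubset; split=> v // _; exists (cst v).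
move=> W /= /ux Wu; exists (@^~ n @^-1` W) => //.
by rewrite eqEsubset; split=> [v [? ? <-]//|v Wv]; exists (cst v).
Qed.

Lemma eval_continuous (n : int) :
  continuous (fun x : {ptws int -> Sigma} => x n).
Proof. exact: (@proj_continuous _ (fun=> Sigma) n). Qed.

Lemma shiftz_continuous (k : int) :
  continuous (@shiftz Sigma k).
Proof. by move=> x; apply: (ptws_cvg (FF := nbhs_filter x)) => n; exact: (@eval_continuous (n + k) x). Qed.

Lemma closure_Orb_ind x y (C : set {ptws int -> Sigma}) :
  closed C -> (forall k, C (shiftz k x)) -> closure (Orb x) y -> C y.
Proof.
move=> Ccl xC xy; apply: Ccl.
by apply: closureS xy => _ [k _ <-].
Qed.

Lemma closure_Orb_sub x y :
  closure (Orb x) y -> closure (Orb y) `<=` closure (Orb x).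
Proof.
move=> xy z; apply: closure_Orb_ind; first exact: closed_closure.
move=> k; apply: (@closure_Orb_ind x y (shiftz k @^-1` closure (Orb x)) _ _ xy).
  by apply: preimage_closed => [? _|]; [exact: shiftz_continuous|exact: closed_closure].
by move=> l; apply: subset_closure; rewrite shiftzD; exact: mem_shift_Orb.
Qed.

(** Minimality of the orbit closure of a recurrent point.  If the return times
    to a neighbourhood [V] of [x] have gaps at most [N], the whole orbit of [x]
    is covered by [S^-r V] for [r < N]; passing to the closures of these
    finitely many sets, so is [y].  Regularity makes the closure of [V] fit in
    any prescribed neighbourhood of [x]. *)
Lemma recurrent_closure_Orb x y :
  regular_space {ptws int -> Sigma} -> recurrent x ->
  closure (Orb x) y -> closure (Orb x) = closure (Orb y).
Proof.
move=> reg rec xy; rewrite eqEsubset; split; last exact: closure_Orb_sub.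
apply: closure_Orb_sub => U /(reg x) [V Vx VU].
have [N [N0 ret]] := rec V^° (open_interior V) Vx.
pose C := \bigcup_(r in `I_N) (shiftz r @^-1` closure V).
have [] : C y.
  apply: (@closure_Orb_ind x y) xy.
    apply: closed_bigcup; first exact: finite_II.
    move=> r _; apply: preimage_closed; last exact: closed_closure.
    by move=> ? _; exact: shiftz_continuous.
  move=> k; have [_ [/[swap] [[i /andP[ki iN] <-] Vix]]] := ret k.
  exists `|i - k|%N; first by rewrite /=; lia.
  rewrite /= shiftzD (_ : _ + k = i); last by lia.
  by apply: subset_closure; exact: interior_subset.
move=> r _ yr; exists (shiftz r y); split; first exact: mem_shift_Orb.
exact: VU.
Qed.

Lemma ptws_regular : compact [set: Sigma] -> hausdorff_space Sigma ->
  regular_space {ptws int -> Sigma}.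
Proof.
move=> Sc Sh x; apply: (@compact_regular _ x setT); last exact: filterT.
  exact: (@hausdorff_product _ (fun=> Sigma)).
have := @tychonoff int (fun=> Sigma) (fun=> setT) (fun=> Sc).
by congr compact; rewrite eqEsubset.
Qed.

(** * Essential periods of points with the same orbit closure *)

(** A shift [S^k x] satisfies the conclusion with [c = k], or with the residue of
    [k] modulo [p]; so the orbit of [x] is covered by [p] sets, one for each
    residue, and they are closed because they prescribe values at given
    coordinates. *)
Lemma Per_closure x y (p : nat) : accessible_space Sigma -> (0 < p)%N ->
  closure (Orb x) y ->
  exists c : int, forall s n, Per p x s n -> Per p y s (n - c).
Proof.
move=> Sa p0 xy.
pose D (c : int) := \bigcap_(ns in [set ns : int * Sigma | Per p x ns.2 ns.1])
  [set z : {ptws int -> Sigma} | z (ns.1 - c) = ns.2].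
have Dcl c : closed (D c).
  apply: closed_bigI => -[n s] _ /=.
  apply: (@preimage_closed _ _ (fun z : {ptws int -> Sigma} => z (n - c)) [set s]).
    by move=> ? _; exact: eval_continuous.
  exact: accessible_closed_set1.
have [c _ Dy] : (\bigcup_(c in `I_p) D c%:Z) y.
  apply: (@closure_Orb_ind x y) xy; first by apply: closed_bigcup; [exact: finite_II|].
  move=> k; exists `|(k %% p)%Z|%N; first by rewrite /=; lia.
  move=> [n s] /= xn; rewrite /shiftz; apply: xn; apply/eqmod_dvdz.
  rewrite (_ : _ - n = (k %/ p)%Z * p%:Z); first exact: dvdz_mull.
  by have := divz_eq k p; lia.
exists c => s n xn n' /eqmod_dvdz n'n.
have /(Dy (n' + c, s)) /= : Per p x s (n' + c).
  move=> m /eqmod_dvdz mn'; apply: xn; apply/eqmod_dvdz.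
  rewrite (_ : m - n = (m - (n' + c%:Z)) + (n' - (n - c%:Z))); last by lia.
  exact: rpredD.
by rewrite addrK.
Qed.

(** Adding a multiple of [p] to a translation by [q] changes nothing, so the
    restriction to positive [q] in the definition is harmless. *)
Lemma essential_period_dvdz (T : Type) (z : {ptws int -> T}) (p : nat) (q : int) :
  essential_period p z ->
  (forall s n, Per p z s n -> Per p z s (n + q)) -> (p %| q)%Z.
Proof.
move=> [p0 ess] sub.
(* [q + |q| p] is nonnegative since [p >= 1]; one more [p] makes it positive. *)
pose q' : int := q + (`|q|%N%:Z + 1) * p%:Z.
have q'0 : 0 < q' by rewrite /q'; nia.
have eqq' : q = `|q'|%N%:Z - (`|q|%N%:Z + 1) * p%:Z.
  by rewrite gtz0_abs // /q' addrK.
rewrite eqq'; apply: rpredB; last exact: dvdz_mull.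
apply: ess => [|s n /sub nq]; first by lia.
exists (n + `|q'|%N%:Z); last by rewrite addrK.
move=> m /eqmod_dvdz mn; apply: nq; apply/eqmod_dvdz; rewrite [X in n + X]eqq'.
rewrite (_ : _ - _ = m - (n + `|q'|%N%:Z) + (`|q|%N%:Z + 1) * p%:Z); last by lia.
by apply: rpredD => //; exact: dvdz_mull.
Qed.

(** Translating by [- c] maps the periodic parts of [x] into those of [y], and
    translating by [- d] maps them back.  If those of [y] are stable under [q],
    then inserting [q] or nothing between the two translations shows that [p]
    divides both [- c + q - d] and [- c - d], hence [q]. *)
Lemma essential_period_closure x y (p : nat) : accessible_space Sigma ->
  closure (Orb x) = closure (Orb y) ->
  essential_period p x -> essential_period p y.
Proof.
move=> Sa xy ess; have p0 := ess.1.
have [c xyc] : exists c : int,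
    forall s n, Per p x s n -> Per p y s (n - c).
  apply: Per_closure => //; rewrite xy.
  by apply: subset_closure; exact: mem_Orb.
have [d yxd] : exists c : int,
    forall s n, Per p y s n -> Per p x s (n - c).
  apply: Per_closure => //; rewrite -xy.
  by apply: subset_closure; exact: mem_Orb.
split=> // q _ qy.
have yq s n : Per p y s n -> Per p y s (n + q).
  by move=> /qy [m ym <-]; rewrite subrK.
have dvd0 : (p %| - c - d)%Z.
  by apply: essential_period_dvdz ess _ => s n /xyc /yxd; rewrite addrA.
have : (p %| - c + q - d)%Z.
  by apply: essential_period_dvdz ess _ => s n /xyc /yq /yxd; rewrite !addrA.
by rewrite addrAC (rpredDl _ dvd0).
Qed.

End Topology.

(** A period of [y] preserves every [Per_p(y, s)], so it is a multiple of every
    essential period. *)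
Lemma aperiodic_of_essential (T : Type) (y : {ptws int -> T}) :
  (forall k : nat, exists2 p : nat, (k < p)%N & essential_period p y) ->
  aperiodic y.
Proof.
move=> ess k k0 yk; have [p kp [_ /(_ k k0) pk]] := ess k.
suff /dvdn_leq : (p %| k)%N by lia.
apply: pk => s n yn; exists (n + k%:Z); last by rewrite addrK.
move=> m /eqmod_dvdz mn; rewrite -(yn (m - k%:Z)); last first.
  by apply/eqmod_dvdz; rewrite -addrA -opprD [_ + n]addrC.
by rewrite -[in RHS]yk /shiftz subrK.
Qed.

(** * Construction of the Toeplitz sequence *)

Lemma Per_block_of_M (R : realType) (T : Type) (x : {ptws int -> T}) (p : nat -> nat) :
  (fun i : nat => M R (p i) x) @ \oo --> +oo%E ->
  forall L i0 : nat, exists i : nat, exists n : int,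
    (i0 <= i)%N /\ forall j : nat, (j < L)%N -> PerU (p i) x (n + j%:Z).
Proof.
move=> /cvgey_ge /[swap] L /(_ L.+1%:R) [K _ KM] i0.
have /(lt_le_trans _) : (L.+1%:R%:E <= M R (p (maxn K i0)) x)%E.
  by apply: KM => /=; exact: leq_maxl.
move=> /(_ L%:R%:E); rewrite lte_fin ltr_nat ltnSn => /(_ isT) /ereal_sup_gt.
move=> [_ [k [n xn] <-]]; rewrite lte_fin ltr_nat => Lk.
exists (maxn K i0), n; split; first exact: leq_maxr.
by move=> j jL; apply: xn; exact: ltn_trans Lk.
Qed.

(** A block of length [2 k + 1 + p i] contains windows of radius [k] centred at
    [p i] consecutive integers, hence one centred in the residue class of [n]
    modulo [p i]. *)
Lemma Per_window_mod (T : Type) (x : {ptws int -> T}) (p : nat -> nat) :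
  (forall i, 0 < p i)%N ->
  (forall L i0 : nat, exists i : nat, exists n : int,
    (i0 <= i)%N /\ forall j : nat, (j < L)%N -> PerU (p i) x (n + j%:Z)) ->
  forall (k i : nat) (n : int), exists jm : nat * int,
    [/\ (i <= jm.1)%N, (p i %| jm.2 - n)%Z &
        forall l : int, (`|l| <= k)%N -> PerU (p jm.1) x (jm.2 + l)].
Proof.
move=> p0 blk k i n; have [j [m [ij xm]]] := blk (k.*2.+1 + p i)%N i.
pose r := ((n - (m + k)) %% p i)%Z.
have r0 : 0 <= r < p i by move: (p0 i); rewrite /r; lia.
exists (j, m + k + r); split=> //=.
  rewrite (_ : _ - n = r - (n - (m + k))); last by lia.
  by apply/eqmod_dvdz; rewrite modz_mod.
move=> l lk; rewrite (_ : _ + l = m + `|(k%:Z + r + l)%R|%N); last by lia.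
by apply: xm; lia.
Qed.

(** The congruence in the hypothesis makes successive windows agree: it keeps the
    position [n_k + l], for [|l| <= k], in the same class modulo [p_{i_k}] at
    all later stages, and [x] is constant on that class. *)
Lemma toeplitz_limit (T : topologicalType) (x : {ptws int -> T}) (p : nat -> nat) :
  (forall i, p i %| p i.+1)%N ->
  (forall (k i : nat) (n : int), exists jm : nat * int,
    [/\ (i <= jm.1)%N, (p i %| jm.2 - n)%Z &
        forall l : int, (`|l| <= k)%N -> PerU (p jm.1) x (jm.2 + l)]) ->
  exists2 eta : {ptws int -> T}, closure (Orb x) eta &
    \bigcup_(i in [set: nat]) PerU (p i) eta = [set: int].
Proof.
move=> pdvd win.
have pdvdW i j : (i <= j)%N -> (p i %| p j)%N.
  by elim: j => [|j IH]; rewrite leq_eqVlt => /predU1P[->//|//]; move/IH/dvdn_trans; apply.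
have {win} [f fP] := @choice (nat * nat * int) (nat * int) _
  (fun t => win t.1.1 t.1.2 t.2).
(* [s k] is the pair of the index [i_k] and the centre [n_k]. *)
pose s := fix s k : nat * int :=
  if k is k'.+1 then f (k, (s k').1, (s k').2) else f (0%N, 0%N, 0).
have sP k (l : int) : (`|l| <= k)%N -> PerU (p (s k).1) x ((s k).2 + l).
  by case: k => [|k] lk; [have [_ _] := fP (0%N, 0%N, 0)|
    have [_ _] := fP (k.+1, (s k).1, (s k).2)]; exact.
have sM k d : ((s k).1 <= (s (k + d)).1)%N /\
    (p (s k).1 %| (s (k + d)%N).2 - (s k).2)%Z.
  elim: d => [|d [IH1 IH2]]; first by rewrite addn0 subrr dvdz0.
  rewrite addnS; have [le dv _] := fP ((k + d).+1, (s (k + d)%N).1, (s (k + d)%N).2).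
  split; first exact: leq_trans le.
  have -> : (s (k + d).+1).2 - (s k).2 =
    ((s (k + d).+1).2 - (s (k + d)%N).2) + ((s (k + d)%N).2 - (s k).2) by lia.
  apply: rpredD => //; apply: dvdz_trans dv; exact: pdvdW.
(* At position [m] the sequence stabilizes from stage [|m|] on. *)
pose eta : {ptws int -> T} := fun m => x ((s `|m|%N).2 + m).
have etaE k m : (`|m| <= k)%N -> eta m = x ((s k).2 + m).
  move=> mk; have [sg _ xsg] := sP `|m|%N m (leqnn _).
  rewrite /eta (xsg _ erefl) xsg //; apply/eqmod_dvdz.
  have [_] := sM `|m|%N (k - `|m|)%N; rewrite subnKC //.
  by congr (_ %| _)%Z; lia.
exists eta.
  have cv : (fun k => shiftz (s k).2 x) @ \oo --> eta.
    apply: ptws_cvg => m; apply: cvg_near_cst.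
    by exists `|m|%N => // k /= mk; rewrite /shiftz (etaE k) // addrC.
  apply: (closed_cvg _ (@closed_closure _ (Orb x)) _ eta cv).
  by apply: nearW => k; apply: subset_closure; exact: mem_shift_Orb.
rewrite eqEsubset; split=> // m _; exists (s `|m|%N).1 => //.
have [sg _ xsg] := sP `|m|%N m (leqnn _); exists sg => // m' /eqmod_dvdz m'm.
have [_ d1] := sM `|m|%N `|m'|%N.
rewrite (etaE (`|m| + `|m'|)%N) ?leq_addl //; apply: xsg; apply/eqmod_dvdz.
rewrite (_ : _ - _ = ((s (`|m| + `|m'|)%N).2 - (s `|m|%N).2) + (m' - m)); last by lia.
exact: rpredD.
Qed.

Theorem theorem1 (R : realType) (Sigma : topologicalType)
  (Sigma_compact : compact [set: Sigma])
  (Sigma_hausdorff : hausdorff_space Sigma)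
  (x : {ptws int -> Sigma})
  (x_aperiodic : aperiodic x)
  (x_recurrent : recurrent x)
  (x_limsup : limn_esup (fun p : nat => M R p x) = +oo%E)
  (p : nat -> nat)
  (p_increasing : forall i j : nat, (i < j)%N -> (p i < p j)%N)
  (p_essential : forall i : nat, essential_period (p i) x)
  (p_dvd : forall i : nat, (p i %| p i.+1)%N)
  (p_lim : (fun i : nat => M R (p i) x) @ \oo --> +oo%E) :
  exists eta : {ptws int -> Sigma},
    [/\ toeplitz eta,
        aperiodic eta,
        closure (Orb x) = closure (Orb eta) &
        [/\ forall i : nat, essential_period (p i) eta,
            forall i : nat, (p i %| p i.+1)%N &
            \bigcup_(i in [set: nat]) PerU (p i) eta = [set: int]]].
Proof.
have p_gt0 i : (0 < p i)%N := (p_essential i).1.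
have [eta x_eta eta_cover] := toeplitz_limit p_dvd
  (Per_window_mod p_gt0 (Per_block_of_M p_lim)).
have same_closure := recurrent_closure_Orb
  (ptws_regular Sigma_compact Sigma_hausdorff) x_recurrent x_eta.
have eta_essential i : essential_period (p i) eta.
  exact: essential_period_closure (hausdorff_accessible Sigma_hausdorff)
    same_closure (p_essential i).
have p_gtid i : (i < p i)%N.
  elim: i => [|i IH]; first exact: p_gt0.
  exact: leq_ltn_trans IH (p_increasing _ _ (ltnSn i)).
exists eta; split=> //.
  rewrite /toeplitz /Aper -subset0 => m; apply.
  have [i _ im] : (\bigcup_(i in [set: nat]) PerU (p i) eta) m by rewrite eta_cover.
  by exists (p i); first exact: p_gt0.
by apply: aperiodic_of_essential => k; exists (p k).
Qed.
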